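(* Let $\sigma\in\Gamma_{0,p'}$. If $a\in A$ has image $\gamma\in\Gamma_0$, then $\operatorname{Int}(a)(\mathcal H_\sigma)=\mathcal H_{\gamma\sigma\gamma^{-1}}$. Consequently, the stabilizer of $\mathcal H_\sigma$ in $\Gamma_0$ is the centralizer $C_{\Gamma_0}(\sigma)$. The induced action of $C_{\Gamma_0}(\sigma)$ on the set of $G$-conjugacy classes in $\mathcal H_\sigma$ factors through $C_{\Gamma_0}(\sigma)/\langle\sigma\rangle$. In particular, if $C_{\Gamma_0}(\sigma)=\langle\sigma\rangle$, then two morphisms in $\mathcal H_\sigma$ are $A$-conjugate if and only if they are $G$-conjugate.
   Context: $K$ is an algebraically closed field of characteristic $p\ge0$ and $m\ge1$ is an integer. $G$ is a connected semisimple algebraic group over $K$ with a fixed pinning $(B,T,(\epsilon_\alpha)_{\alpha\in\Pi})$ ($T\subset B$ a maximal torus in a Borel subgroup, $\Pi$ the corresponding base of the root system, $\epsilon_\alpha$ an isomorphism of the additive group $K$ onto the root subgroup of $\alpha$). $\Gamma_G$ is the automorphism group of the based root datum of $G$ relative to $(B,T)$; each $\gamma\in\Gamma_G$ gives a unique $\dot\gamma\in\operatorname{Aut}G$ preserving $B$ and $T$ with $\dot\gamma\circ\epsilon_\alpha=\epsilon_{\gamma(\alpha)}$ for all $\alpha\in\Pi$. $\Gamma_0\le\Gamma_G$ is a subgroup, $A=G\rtimes\Gamma_0$ with the action $\gamma\mapsto\dot\gamma$, $\mathbf A$ is the associated smooth affine group scheme, and $\pi\colon\mathbf A\to\boldsymbol\Gamma_0$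 is the quotient map to the constant group scheme associated to $\Gamma_0$. $\boldsymbol{\mu}_m$ is the group scheme of $m$-th roots of unity over $K$. Write $m=m'p^k$ with $\gcd(m',p)=1$ if $p>0$, and $m'=m$ if $p=0$; fix a primitive $m'$-th root of unity $\zeta_{m'}\in\boldsymbol{\mu}_m(K)$. $\Gamma_{0,p'}=\{\sigma\in\Gamma_0\mid p\nmid\operatorname{ord}(\sigma)\}$ (all of $\Gamma_0$ if $p=0$). For $\sigma\in\Gamma_0$, $\mathcal H_\sigma=\{\eta\in\operatorname{Hom}(\boldsymbol{\mu}_m,\mathbf A)\mid\pi_K(\eta_K(\zeta_{m'}))=\sigma\}$. $\operatorname{Int}(a)$ is conjugation by $a$, acting on morphisms by $\eta\mapsto\operatorname{Int}(a)\circ\eta$, and $\operatorname{Int}(a)(\mathcal H_\sigma)$ is the image of $\mathcal H_\sigma$ under this action; two morphisms are $A$-conjugate (respectively $G$-conjugate) if they are related by $\operatorname{Int}(a)$ for some $a\in A$ (respectively $a\in G$). Each $\mathcal H_\sigma$ is stable under conjugation by $G$, so $\Gamma_0=A/G$ acts on the blocks $\mathcal H_\sigma$ and on the $G$-conjugacy classes of morphisms.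
   Formalization: The stabilizer of H_σ as a set is shown to be C(σ) only when H_σ is nonempty (an empty block is stabilized by all of Γ_0, e.g. m=1, σ a transposition in S_3, type D4, p≠2); for every σ it is also shown for blocks labelled by σ. *)

(* Defs.v *)
From HB Require Import structures.
From mathcomp Require Import all_boot all_order all_algebra.
From mathcomp Require Import boolp classical_sets.

Set Implicit Arguments.
Unset Strict Implicit.
Unset Printing Implicit Defensive.

Import GRing.Theory.
Local Open Scope classical_set_scope.
Local Open Scope ring_scope.

(* Since K is algebraically closed, a smooth affine group scheme over K is     *)
(* determined by its group of K-points together with the K-algebra of regular  *)
(* functions on it.  A funGroup is an abstract group with an arbitrary         *)
(* subalgebra of K-valued functions; is_algebraic singles out the affine       *)
(* algebraic groups.                                                           *)
Record funGroup (K : fieldType) := FunGroup {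
  fg_pts :> groupType;
  regfun : set (fg_pts -> K);
  regfun_cst : forall c : K, regfun (fun=> c);
  regfunD : forall f g, regfun f -> regfun g -> regfun (fun x => f x + g x);
  regfunM : forall f g, regfun f -> regfun g -> regfun (fun x => f x * g x)
}.

Record coordRing (K : fieldType) (G : funGroup K) := CoordRing {
  cr_fun :> G -> K;
  cr_regular : regfun cr_fun
}.

Section CoordRing.
Variables (K : fieldType) (G : funGroup K).
Local Notation O := (coordRing G).
Implicit Types f g h : O.

Lemma coordRingP f g : (forall x, f x = g x) -> f = g.
Proof.
case: f g => [f fP] [g gP] /= /funext fg.
by case: _ / fg gP => gP; rewrite (Prop_irrelevance fP gP).
Qed.

HB.instance Definition _ := gen_eqMixin O.
HB.instance Definition _ := gen_choiceMixin O.

Definition cr_cst (c : K) : O := CoordRing (@regfun_cst K G c).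
Definition cr_add f g : O := CoordRing (regfunD (cr_regular f) (cr_regular g)).
Definition cr_mul f g : O := CoordRing (regfunM (cr_regular f) (cr_regular g)).

Lemma cr_addA : associative cr_add.
Proof. by move=> f g h; apply: coordRingP => x /=; rewrite addrA. Qed.
Lemma cr_addC : commutative cr_add.
Proof. by move=> f g; apply: coordRingP => x /=; rewrite addrC. Qed.
Lemma cr_add0 : left_id (cr_cst 0) cr_add.
Proof. by move=> f; apply: coordRingP => x /=; rewrite add0r. Qed.
Lemma cr_addN : left_inverse (cr_cst 0) (cr_mul (cr_cst (-1))) cr_add.
Proof. by move=> f; apply: coordRingP => x /=; rewrite mulN1r addNr. Qed.
HB.instance Definition _ := GRing.isZmodule.Build O cr_addA cr_addC cr_add0 cr_addN.

Lemma cr_mulA : associative cr_mul.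
Proof. by move=> f g h; apply: coordRingP => x /=; rewrite mulrA. Qed.
Lemma cr_mulC : commutative cr_mul.
Proof. by move=> f g; apply: coordRingP => x /=; rewrite mulrC. Qed.
Lemma cr_mul1 : left_id (cr_cst 1) cr_mul.
Proof. by move=> f; apply: coordRingP => x /=; rewrite mul1r. Qed.
Lemma cr_mulD : left_distributive cr_mul cr_add.
Proof. by move=> f g h; apply: coordRingP => x /=; rewrite mulrDl. Qed.
Lemma cr_1neq0 : cr_cst 1 != 0 :> O.
Proof.
by apply/eqP => /(congr1 (fun f : O => f 1%g)) /= /eqP; rewrite oner_eq0.
Qed.
HB.instance Definition _ := GRing.Zmodule_isComNzRing.Build O
  cr_mulA cr_mulC cr_mul1 cr_mulD cr_1neq0.

Definition cr_scale (c : K) f : O := cr_mul (cr_cst c) f.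
Lemma cr_scaleA a b f : cr_scale a (cr_scale b f) = cr_scale (a * b) f.
Proof. by apply: coordRingP => x /=; rewrite mulrA. Qed.
Lemma cr_scale1 : left_id 1 cr_scale.
Proof. by move=> f; apply: coordRingP => x /=; rewrite mul1r. Qed.
Lemma cr_scaleDr : right_distributive cr_scale +%R.
Proof. by move=> c f g; apply: coordRingP => x /=; rewrite mulrDr. Qed.
Lemma cr_scaleDl f : {morph cr_scale^~ f : a b / a + b}.
Proof. by move=> a b; apply: coordRingP => x /=; rewrite mulrDl. Qed.
HB.instance Definition _ := GRing.Zmodule_isLmodule.Build K O
  cr_scaleA cr_scale1 cr_scaleDr cr_scaleDl.

Lemma cr_scaleAl (c : K) (f g : O) : c *: (f * g) = c *: f * g.
Proof. by apply: coordRingP => x /=; rewrite mulrA. Qed.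
HB.instance Definition _ := GRing.Lmodule_isLalgebra.Build K O cr_scaleAl.
HB.instance Definition _ := GRing.Lalgebra_isComAlgebra.Build K O.

End CoordRing.

(* The R-points of the affine scheme Spec K[G].                                *)
Definition gpt (K : fieldType) (G : funGroup K) (R : comAlgType K) :=
  {lrmorphism coordRing G -> R}.

Section Points.
Variables (K : fieldType) (G : funGroup K).

(* f is the image of the tensor \sum_(p <- s) p.1 (x) p.2 under K[G] -> K[G] (x) K[G]. *)
Definition comul (f : coordRing G) (s : seq (coordRing G * coordRing G)) :=
  forall x y : G, f (x * y)%g = \sum_(p <- s) p.1 x * p.2 y.

(* z is the product of x and y in the group of R-points of G.                  *)
Definition is_prod (R : comAlgType K) (x y z : gpt G R) :=
  forall f s, comul f s -> z f = \sum_(p <- s) x p.1 * y p.2.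

Definition ev_at (a : G) : coordRing G -> K^o := fun f => f a.
Lemma ev_at_is_linear a : linear (ev_at a). Proof. by []. Qed.
Lemma ev_at_is_mult a : monoid_morphism (ev_at a). Proof. by []. Qed.
HB.instance Definition _ a :=
  GRing.isLinear.Build K (coordRing G) K^o _ (ev_at a) (ev_at_is_linear a).
HB.instance Definition _ a :=
  GRing.isMonoidMorphism.Build (coordRing G) K^o (ev_at a) (ev_at_is_mult a).

Definition kpt (a : G) : gpt G K^o := ev_at a.

Definition is_algebraic :=
  [/\ (* K[G] is finitely generated *)
      exists s : seq (coordRing G), forall A : set (coordRing G),
        (forall c : K, A c%:A) -> (forall f g, A f -> A g -> A (f + g)) ->
        (forall f g, A f -> A g -> A (f * g)) ->
        (forall f, f \in s -> A f) -> forall f, A f,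
      (* G is the set of K-points of Spec K[G] *)
      forall x : gpt G K^o, exists! a : G, forall f, x f = kpt a f,
      forall f : coordRing G, exists s, comul f s &
      forall f : coordRing G, regfun (fun x : G => f x^-1%g)].

End Points.

Section Subgroups.
Variables (K : fieldType) (G : funGroup K).
Implicit Types H C : set G.

Definition zclosed C :=
  exists E : set (coordRing G), C = [set x | forall f, E f -> f x = 0].

Definition subgroup H :=
  [/\ H 1%g, forall x y, H x -> H y -> H (x * y)%g & forall x, H x -> H x^-1%g].

Definition zconnected H := forall C1 C2, zclosed C1 -> zclosed C2 ->
  H `<=` C1 `|` C2 -> H `&` C1 `&` C2 = set0 -> H `<=` C1 \/ H `<=` C2.

Definition generated H : set G :=
  [set x | forall L, subgroup L -> H `<=` L -> L x].
Definition derived H :=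
  generated [set z | exists x y, [/\ H x, H y & z = [~ x, y]%g]].
Definition solvable_grp H := exists n, iter n derived H = [set 1%g].

Definition normal_grp H := forall x y, H y -> H (x * y * x^-1)%g.

Definition semisimple := forall H, subgroup H -> zclosed H -> zconnected H ->
  solvable_grp H -> normal_grp H -> H = [set 1%g].

Definition csc H := [/\ subgroup H, zclosed H, zconnected H & solvable_grp H].
Definition borel B := csc B /\ forall H, csc H -> B `<=` H -> H = B.

(* T is closed and (c_0, ..., c_(n-1)) : T -> (K^* )^n is an isomorphism of    *)
(* algebraic groups: the last clause says that its inverse is a morphism.      *)
Definition torus T := [/\ subgroup T, zclosed T &
  exists n (c : 'I_n -> coordRing G),
  [/\ forall i x, T x -> c i x != 0,
      forall i x y, T x -> T y -> c i (x * y)%g = c i x * c i y,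
      forall u : 'I_n -> K, (forall i, u i != 0) ->
        exists! t, T t /\ forall i, c i t = u i &
      forall f : coordRing G, exists s : seq (K * ('I_n -> int)), forall t, T t ->
        f t = \sum_(q <- s) q.1 * \prod_(i < n) c i t ^ q.2 i]].
Definition max_torus T := torus T /\ forall T', torus T' -> T `<=` T' -> T' = T.

Definition identity_component H : set G :=
  [set x | exists L, [/\ subgroup L, zclosed L, zconnected L & L `<=` H /\ L x]].
Definition centralizer_grp H : set G := [set x | forall y, H y -> (x * y = y * x)%g].

(* The tangent space at 1 of the closed subgroup H, inside Lie(G): point       *)
(* derivations of K[G] that vanish on the ideal of H.                          *)
Definition lie H (d : coordRing G -> K) :=
  [/\ forall (c : K) f g, d (c *: f + g) = c * d f + d g,
      forall f g : coordRing G, d (f * g) = f 1%g * d g + d f * g 1%g &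
      forall f : coordRing G, (forall x, H x -> f x = 0) -> d f = 0].

End Subgroups.

Record borelTorusGroup (K : fieldType) := BorelTorusGroup {
  bt_grp :> funGroup K;
  bt_algebraic : is_algebraic bt_grp;
  bt_connected : zconnected [set: bt_grp];
  bt_semisimple : semisimple bt_grp;
  bt_B : set bt_grp;
  bt_T : set bt_grp;
  bt_borel : borel bt_B;
  bt_torus : max_torus bt_T;
  bt_sub : bt_T `<=` bt_B
}.

(* Morphisms of algebraic groups T -> K^*, extended by 0 outside T so that     *)
(* equality of characters is equality of functions.                            *)
Record character (K : fieldType) (G : borelTorusGroup K) := Character {
  ch_fun :> G -> K;
  ch_off : forall x, ~ bt_T x -> ch_fun x = 0;
  ch_unit : forall x, bt_T x -> ch_fun x != 0;
  ch_mul : forall x y, bt_T x -> bt_T y -> ch_fun (x * y)%g = ch_fun x * ch_fun y;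
  ch_regular : exists f g : coordRing G,
    forall x, bt_T x -> f x = ch_fun x /\ g x = (ch_fun x)^-1
}.

Section Characters.
Variables (K : fieldType) (G : borelTorusGroup K).
Local Notation T := (@bt_T K G).
Local Notation X := (character G).
Implicit Types chi psi : X.

Lemma characterP chi psi : (forall x, T x -> chi x = psi x) -> chi = psi.
Proof.
move=> eq_cp; have /funext : forall x, chi x = psi x.
  move=> x; have [Tx|nTx] := pselect (T x); first exact: eq_cp.
  by rewrite !ch_off.
case: chi psi {eq_cp} => [f a1 a2 a3 a4] [g b1 b2 b3 b4] /= fg.
by case: _ / fg b1 b2 b3 b4 => *; congr Character; exact: Prop_irrelevance.
Qed.

Lemma bt_T_subgroup : subgroup T.
Proof. by case: (bt_torus G) => -[]. Qed.

Definition ch0_fun (x : G) : K := if `[< T x >] then 1 else 0.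
Lemma ch0_in x : T x -> ch0_fun x = 1.
Proof. by move=> Tx; rewrite /ch0_fun asboolT. Qed.
Definition ch0 : X.
Proof.
exists ch0_fun.
- by move=> x nTx; rewrite /ch0_fun asboolF.
- by move=> x /ch0_in ->; exact: oner_neq0.
- move=> x y Tx Ty; rewrite !ch0_in ?mulr1 //.
  by case: bt_T_subgroup => _ + _; apply.
- exists 1, 1 => x /ch0_in ->; split=> //=; by rewrite invr1.
Defined.

Definition ch_add chi psi : X.
Proof.
exists (fun x => chi x * psi x).
- by move=> x nTx; rewrite ch_off ?mul0r.
- by move=> x Tx; rewrite mulf_neq0 ?ch_unit.
- by move=> x y Tx Ty; rewrite !ch_mul // mulrACA.
- have [f [g fg]] := ch_regular chi; have [f' [g' fg']] := ch_regular psi.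
  exists (f * f'), (g * g') => x Tx /=; rewrite invfM.
  by have [-> ->] := fg x Tx; have [-> ->] := fg' x Tx.
Defined.

Definition ch_opp chi : X.
Proof.
exists (fun x => (chi x)^-1).
- by move=> x nTx; rewrite ch_off ?invr0.
- by move=> x Tx; rewrite invr_eq0 ch_unit.
- by move=> x y Tx Ty; rewrite ch_mul // invfM.
- have [f [g fg]] := ch_regular chi; exists g, f => x Tx; rewrite invrK.
  by have [-> ->] := fg x Tx.
Defined.

HB.instance Definition _ := gen_eqMixin X.
HB.instance Definition _ := gen_choiceMixin X.
Lemma ch_addA : associative ch_add.
Proof. by move=> a b c; apply: characterP => x _ /=; rewrite mulrA. Qed.
Lemma ch_addC : commutative ch_add.
Proof. by move=> a b; apply: characterP => x _ /=; rewrite mulrC. Qed.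
Lemma ch_add0 : left_id ch0 ch_add.
Proof. by move=> a; apply: characterP => x Tx /=; rewrite ch0_in ?mul1r. Qed.
Lemma ch_addN : left_inverse ch0 ch_opp ch_add.
Proof.
by move=> a; apply: characterP => x Tx /=; rewrite ch0_in ?mulVf ?ch_unit.
Qed.
HB.instance Definition _ := GRing.isZmodule.Build X ch_addA ch_addC ch_add0 ch_addN.

Definition weight_in (H : set G) (chi : X) := exists d : coordRing G -> K,
  [/\ lie H d, exists f, d f <> 0 &
      (* Ad(t) d = chi(t) d, where (Ad(t) d)(f) = d (f o Int t) *)
      forall t, T t -> forall f h : coordRing G,
        (forall x, h x = f (t * x * t^-1)%g) -> d h = chi t * d f].

Definition root (a : X) := a <> 0 /\ weight_in [set: G] a.
Definition positive_root (a : X) := a <> 0 /\ weight_in (@bt_B K G) a.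
Definition simple_root (a : X) := positive_root a /\
  ~ exists b c, [/\ positive_root b, positive_root c & a = b + c].

(* Values of a cocharacter at 0 are irrelevant. *)
Definition cocharacter (l : K -> G) :=
  [/\ forall u, u != 0 -> T (l u),
      forall u v, u != 0 -> v != 0 -> l (u * v) = (l u * l v)%g &
      forall f : coordRing G, exists s : seq (K * int), forall u, u != 0 ->
        f (l u) = \sum_(q <- s) q.1 * u ^ q.2].

(* c = <-, a^vee> as a linear form on X(T), where a^vee is the cocharacter for *)
(* which the reflection chi |-> chi - <chi, a^vee> a is induced by an element  *)
(* normalizing T in the rank one group C_G((ker a)^0).                         *)
Definition coroot (a : X) (c : X -> int) := c a = 2%:Z /\
  exists (l : K -> G) (n : G),
  [/\ cocharacter l, forall chi u, u != 0 -> chi (l u) = u ^ c chi,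
      centralizer_grp (identity_component (T `&` [set t | a t = 1])) n,
      forall t, T (n^-1 * t * n)%g <-> T t &
      forall chi t, T t -> chi (n^-1 * t * n)%g = (chi - a *~ c chi) t].

End Characters.

(* Automorphisms of the based root datum (X(T), Phi, X(T)^vee, Phi^vee, Pi);   *)
(* the cocharacter lattice is identified with the dual of X(T), on which the   *)
(* automorphism acts contragrediently.                                         *)
Record basedAut (K : fieldType) (G : borelTorusGroup K) := BasedAut {
  ba_fun :> character G -> character G;
  ba_inv : character G -> character G;
  ba_funK : cancel ba_fun ba_inv;
  ba_invK : cancel ba_inv ba_fun;
  baD : {morph ba_fun : chi psi / chi + psi};
  ba_root : forall a, root (ba_fun a) <-> root a;
  ba_coroot : forall a c, root a ->
    (coroot (ba_fun a) (c \o ba_inv) <-> coroot a c);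
  ba_simple : forall a, simple_root (ba_fun a) <-> simple_root a
}.

Section BasedAut.
Variables (K : fieldType) (G : borelTorusGroup K).
Local Notation Gam := (basedAut G).
Implicit Types s t : Gam.

Lemma basedAutP s t : (forall chi, s chi = t chi) -> s = t.
Proof.
move=> /funext st.
have ti : ba_inv s = ba_inv t.
  by apply: funext => x; rewrite -{1}[x](ba_invK t) -st ba_funK.
case: s t st ti => [f i a1 a2 a3 a4 a5 a6] [g j b1 b2 b3 b4 b5 b6] /= fg ij.
case: _ / fg b1 b2 b3 b4 b5 b6 => b1 b2 b3 b4; case: _ / ij b1 b2 => *.
by congr BasedAut; exact: Prop_irrelevance.
Qed.

Definition ba_one : Gam.
Proof. by exists id id. Defined.

Definition ba_mul s t : Gam.
Proof.
exists (s \o t) (ba_inv t \o ba_inv s).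
- by move=> x /=; rewrite !ba_funK.
- by move=> x /=; rewrite !ba_invK.
- by move=> x y /=; rewrite !baD.
- by move=> a /=; rewrite !ba_root.
- move=> a c ra; have rta : root (t a) by rewrite ba_root.
  exact: iff_trans (ba_coroot s (c \o ba_inv t) rta) (ba_coroot t c ra).
- by move=> a /=; rewrite !ba_simple.
Defined.

Definition ba_V s : Gam.
Proof.
exists (ba_inv s) s.
- exact: ba_invK.
- exact: ba_funK.
- by move=> x y; apply: (can_inj (ba_funK s)); rewrite baD !ba_invK.
- by move=> a; rewrite -(ba_root s) ba_invK.
- move=> a c ra; have rsa : root (ba_inv s a) by rewrite -(ba_root s) ba_invK.
  rewrite -(ba_coroot s (c \o s) rsa) ba_invK.
  suff -> : (c \o s) \o ba_inv s = c by [].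
  by apply: funext => x /=; rewrite ba_invK.
- by move=> a; rewrite -(ba_simple s) ba_invK.
Defined.

HB.instance Definition _ := gen_eqMixin Gam.
HB.instance Definition _ := gen_choiceMixin Gam.
Lemma ba_mulA : associative ba_mul. Proof. by move=> *; exact: basedAutP. Qed.
Lemma ba_mul1 : left_id ba_one ba_mul. Proof. by move=> *; exact: basedAutP. Qed.
Lemma ba_mulg1 : right_id ba_one ba_mul. Proof. by move=> *; exact: basedAutP. Qed.
Lemma ba_mulV : left_inverse ba_one ba_V ba_mul.
Proof. by move=> s; apply: basedAutP => x /=; rewrite ba_funK. Qed.
Lemma ba_mulgV : right_inverse ba_one ba_V ba_mul.
Proof. by move=> s; apply: basedAutP => x /=; rewrite ba_invK. Qed.
HB.instance Definition _ := isGroup.Build Gam ba_mulA ba_mul1 ba_mulg1 ba_mulV ba_mulgV.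

(* For every simple root a, eps a is an isomorphism of algebraic groups from   *)
(* (K, +) onto the root subgroup of a; the other values of eps are irrelevant. *)
Definition pinning (eps : character G -> K -> G) := forall a, simple_root a ->
  [/\ forall x y, eps a (x + y) = (eps a x * eps a y)%g,
      forall f : coordRing G, exists q : {poly K}, forall x, f (eps a x) = q.[x],
      exists f : coordRing G, forall x, f (eps a x) = x &
      forall (t : G) x, bt_T t -> (t * eps a x * t^-1)%g = eps a (a t * x)].

Definition algebraic_aut (phi : G -> G) :=
  [/\ bijective phi, {morph phi : x y / (x * y)%g} &
      forall f : G -> K, regfun (f \o phi) <-> regfun f].

Definition pinned_aut (eps : character G -> K -> G) s (phi : G -> G) :=
  [/\ algebraic_aut phi, phi @` @bt_B K G = @bt_B K G,
      phi @` @bt_T K G = @bt_T K G &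
      forall a x, simple_root a -> phi (eps a x) = eps (s a) x].

End BasedAut.

(* The last field is not an extra assumption: by the isomorphism theorem it    *)
(* holds for every pinning of a connected semisimple group.                    *)
Record pinnedGroup (K : fieldType) := PinnedGroup {
  pg_grp :> borelTorusGroup K;
  pg_eps : character pg_grp -> K -> pg_grp;
  pg_pinning : pinning pg_eps;
  pg_dot : forall s : basedAut pg_grp, exists phi : pg_grp -> pg_grp,
    [/\ pinned_aut pg_eps s phi,
        forall chi t, bt_T t -> s chi (phi t) = chi t &
        forall psi, pinned_aut pg_eps s psi -> psi = phi]
}.

Section Dot.
Variables (K : fieldType) (G : pinnedGroup K).
Implicit Types s t : basedAut G.

Definition dot s : G -> G := projT1 (cid (pg_dot s)).

Lemma dotP s : pinned_aut (@pg_eps K G) s (dot s).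
Proof. by rewrite /dot; case: cid => /= phi []. Qed.

Lemma dot_unique s psi : pinned_aut (@pg_eps K G) s psi -> psi = dot s.
Proof. by rewrite /dot; case: cid => /= phi [_ _]; apply. Qed.

Lemma dotM s x y : dot s (x * y)%g = (dot s x * dot s y)%g.
Proof. by have [[_ m _] _ _ _] := dotP s; exact: m. Qed.

Lemma dot_id x : dot 1%g x = x.
Proof.
rewrite -(@dot_unique 1%g id) //; split=> //; rewrite ?image_id //.
by split=> //; exists id.
Qed.

Lemma dot_mul s t x : dot (s * t)%g x = dot s (dot t x).
Proof.
suff /dot_unique <- : pinned_aut (@pg_eps K G) (s * t)%g (dot s \o dot t) by [].
have [[bs ms rs] Bs Ts es] := dotP s; have [[bt mt rt] Bt Tt et] := dotP t.
split.
- split; first exact: bij_comp.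
    by move=> y z /=; rewrite mt ms.
  by move=> f; rewrite compA rt rs.
- by rewrite -image_comp Bt Bs.
- by rewrite -image_comp Tt Ts.
- by move=> a y sa /=; rewrite et // es // ba_simple.
Qed.

End Dot.

(* A = G x| Gam0, for a subgroup Gam0 of the automorphism group of the based   *)
(* root datum.                                                                 *)
Record outerGroup (K : fieldType) (G : pinnedGroup K) (S : pred (basedAut G))
    (Gam0 : subGroupType S) := Outer { og_ker : G; og_quo : Gam0 }.

Section Outer.
Variables (K : fieldType) (G : pinnedGroup K) (S : pred (basedAut G)).
Variable Gam0 : subGroupType S.
Local Notation A := (outerGroup Gam0).
Implicit Types a b : A.

Definition og_dot (s : Gam0) : G -> G := dot (val s).

Definition og_one : A := Outer 1%g 1%g.
Definition og_mul a b : A :=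
  Outer (og_ker a * og_dot (og_quo a) (og_ker b))%g (og_quo a * og_quo b)%g.
Definition og_V a : A :=
  Outer (og_dot (og_quo a)^-1 (og_ker a)^-1)%g (og_quo a)^-1%g.

HB.instance Definition _ := gen_eqMixin A.
HB.instance Definition _ := gen_choiceMixin A.

Lemma og_dotM s x y : og_dot s (x * y)%g = (og_dot s x * og_dot s y)%g.
Proof. exact: dotM. Qed.
Lemma og_dot_mul s t x : og_dot (s * t)%g x = og_dot s (og_dot t x).
Proof. by rewrite /og_dot valM dot_mul. Qed.
Lemma og_dot_id x : og_dot 1%g x = x.
Proof. by rewrite /og_dot val1 dot_id. Qed.
Lemma og_dot1 s : og_dot s 1%g = 1%g.
Proof. by apply: (mulgI (og_dot s 1%g)); rewrite -og_dotM !mulg1. Qed.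

Lemma og_mulA : associative og_mul.
Proof. by move=> a b c; rewrite /og_mul /= og_dotM og_dot_mul !mulgA. Qed.
Lemma og_mul1 : left_id og_one og_mul.
Proof. by move=> [x s]; rewrite /og_mul /= og_dot_id !mul1g. Qed.
Lemma og_mulg1 : right_id og_one og_mul.
Proof. by move=> [x s]; rewrite /og_mul /= og_dot1 !mulg1. Qed.
Lemma og_mulV : left_inverse og_one og_V og_mul.
Proof.
by move=> [x s]; rewrite /og_mul /og_V /= -og_dotM !mulVg og_dot1.
Qed.
Lemma og_mulgV : right_inverse og_one og_V og_mul.
Proof.
by move=> [x s]; rewrite /og_mul /og_V /= -og_dot_mul !mulgV og_dot_id mulgV.
Qed.
HB.instance Definition _ := isGroup.Build A og_mulA og_mul1 og_mulg1 og_mulV og_mulgV.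

(* As a variety, A is the disjoint union of copies of G indexed by Gam0, and   *)
(* Gam0 is discrete.  (Gam0 is finite, because G is semisimple.)               *)
Definition outer_regular : set (A -> K) :=
  [set f | forall s, regfun (fun x : G => f (Outer x s))].
Lemma outer_regular_cst c : outer_regular (fun=> c).
Proof. by move=> s; exact: regfun_cst. Qed.
Lemma outer_regularD f g : outer_regular f -> outer_regular g ->
  outer_regular (fun a => f a + g a).
Proof. by move=> rf rg s; exact: regfunD (rf s) (rg s). Qed.
Lemma outer_regularM f g : outer_regular f -> outer_regular g ->
  outer_regular (fun a => f a * g a).
Proof. by move=> rf rg s; exact: regfunM (rf s) (rg s). Qed.
Definition outer_fg : funGroup K :=
  FunGroup outer_regular_cst outer_regularD outer_regularM.

Definition discrete_fg : funGroup K :=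
  @FunGroup K Gam0 setT (fun=> I) (fun _ _ _ _ => I) (fun _ _ _ _ => I).

End Outer.

Record fgHom (K : fieldType) (G H : funGroup K) := FgHom {
  fh_fun :> G -> H;
  fh_mul : {morph fh_fun : x y / (x * y)%g};
  fh_regular : forall f : coordRing H, regfun (f \o fh_fun)
}.

Section Hom.
Variables (K : fieldType) (G H : funGroup K) (phi : fgHom G H).

Definition pullback (f : coordRing H) : coordRing G := CoordRing (fh_regular phi f).
Lemma pullback_is_linear : linear pullback.
Proof. by move=> c f g; exact: coordRingP. Qed.
Lemma pullback_is_mult : monoid_morphism pullback.
Proof. by split=> [|f g]; exact: coordRingP. Qed.
HB.instance Definition _ :=
  GRing.isLinear.Build K (coordRing H) (coordRing G) _ pullback pullback_is_linear.
HB.instance Definition _ :=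
  GRing.isMonoidMorphism.Build (coordRing H) (coordRing G) pullback pullback_is_mult.

Definition gpt_map (R : comAlgType K) (x : gpt G R) : gpt H R := x \o pullback.

Lemma gpt_map_prod (R : comAlgType K) (x y z : gpt G R) :
  is_prod x y z -> is_prod (gpt_map x) (gpt_map y) (gpt_map z).
Proof.
move=> xyz f s fs /=.
rewrite (xyz _ [seq (pullback q.1, pullback q.2) | q <- s]) ?big_map //.
by move=> u v /=; rewrite big_map fh_mul fs.
Qed.

End Hom.

Section Mu.
Variables (K : fieldType) (m : nat) (m_gt0 : (0 < m)%N).

(* R-points and coordinate ring of mu_m. *)
Definition mu (R : comAlgType K) := {x : R | x ^+ m == 1}.
Definition muRing : comAlgType K := {poly %/ ('X^m - 1 : {poly K})}.

Definition mu_mul (R : comAlgType K) (x y : mu R) : mu R.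
Proof.
exists (val x * val y).
by rewrite exprMn (eqP (valP x)) (eqP (valP y)) mulr1.
Defined.

(* The homomorphism K[mu_m] -> R given by x in mu_m(R).  (m_gt0 ensures that   *)
(* the library's quotient is the one by 'X^m - 1.)                             *)
Definition mu_ev of (0 < m)%N := fun (R : comAlgType K) (x : mu R) (q : muRing) =>
  horner_alg (val x) (polyn q).

Lemma mu_mod (R : comAlgType K) (x : mu R) (q : {poly K}) :
  horner_alg (val x) (Pdiv.CommonRing.rmodp q (mk_monic ('X^m - 1 : {poly K})))
  = horner_alg (val x) q.
Proof.
have -> : mk_monic ('X^m - 1 : {poly K}) = 'X^m - 1.
  by rewrite /mk_monic size_XnsubC // ltnS m_gt0 monicXnsubC.
rewrite [in RHS](Pdiv.RingMonic.rdivp_eq (monicXnsubC 1 m_gt0) q).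
have x0 : horner_alg (val x) ('X^m - 1%:P : {poly K}) = 0.
  by rewrite rmorphB rmorphXn /= horner_algX horner_algC scale1r (eqP (valP x)) subrr.
by rewrite rmorphD rmorphM /= x0 mulr0 add0r.
Qed.

Lemma mu_ev_is_linear R x : linear (@mu_ev m_gt0 R x).
Proof.
move=> c p q; rewrite /mu_ev -[polyn (c *: p + q)]/(c *: polyn p + polyn q).
by rewrite rmorphD /= linearZ /= mulr_algl.
Qed.
Lemma mu_ev_is_mult R x : monoid_morphism (@mu_ev m_gt0 R x).
Proof.
split=> [|p q]; first by rewrite /mu_ev /= rmorph1.
by rewrite /mu_ev poly_of_qpolyM mu_mod rmorphM.
Qed.
HB.instance Definition _ (R : comAlgType K) (x : mu R) :=
  GRing.isLinear.Build K muRing R _ (@mu_ev m_gt0 R x) (@mu_ev_is_linear R x).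
HB.instance Definition _ (R : comAlgType K) (x : mu R) :=
  GRing.isMonoidMorphism.Build muRing R (@mu_ev m_gt0 R x) (@mu_ev_is_mult R x).

(* eta_R(x), for the morphism eta : mu_m -> Spec K[G] with comorphism co. *)
Definition mu_at (G : funGroup K) (co : {lrmorphism coordRing G -> muRing})
    (R : comAlgType K) (x : mu R) : gpt G R := @mu_ev m_gt0 R x \o co.

(* Homomorphisms of group schemes from mu_m to Spec K[G]; by Yoneda a morphism *)
(* of schemes is the same as its comorphism.                                   *)
Record muHom (G : funGroup K) := MuHom {
  mh_co : {lrmorphism coordRing G -> muRing};
  mh_mul : forall (R : comAlgType K) (x y : mu R),
    is_prod (mu_at mh_co x) (mu_at mh_co y) (mu_at mh_co (mu_mul x y))
}.

Definition mu_comp (G H : funGroup K) (phi : fgHom G H) (eta : muHom G) : muHom H.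
Proof.
exists (mh_co eta \o pullback phi).
by move=> R x y f s fs; exact: (gpt_map_prod phi (mh_mul eta x y)) fs.
Defined.

End Mu.

Section Action.
Variables (K : fieldType) (G : pinnedGroup K) (S : pred (basedAut G)).
Variable Gam0 : subGroupType S.
Local Notation A := (outer_fg Gam0).
Local Notation D := (discrete_fg Gam0).

Definition og_pi : fgHom A D.
Proof.
exists (fun a : A => og_quo a); first by [].
by move=> f s; exact: (regfun_cst G (f s)).
Defined.

Definition og_incl (g : G) : A := Outer g 1%g.

Lemma regfun_translate (g h : G) (f : G -> K) :
  regfun f -> regfun (fun x => f (g * x * h)%g).
Proof.
have [_ _ tr _] := bt_algebraic G.
have sumr (I : Type) (r : seq I) (F : I -> G -> K) :
    (forall i, regfun (F i)) -> regfun (fun x => \sum_(i <- r) F i x).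
  move=> rF; elim: r => [|i r IHr].
    rewrite (_ : (fun=> _) = fun=> 0); first exact: regfun_cst.
    by apply: funext => x; rewrite big_nil.
  rewrite (_ : (fun=> _) = fun x => F i x + \sum_(j <- r) F j x).
    exact: regfunD.
  by apply: funext => x; rewrite big_cons.
have left (f' : G -> K) : regfun f' -> regfun (fun x => f' (g * x)%g).
  move=> rf; have [s fs] := tr (CoordRing rf).
  rewrite (_ : (fun=> _) = fun x => \sum_(q <- s) q.1 g * q.2 x).
    by apply: sumr => q; apply: regfunM; [exact: regfun_cst|exact: cr_regular].
  by apply: funext => x; exact: fs.
move=> rf; have [s fs] := tr (CoordRing rf).
apply: (left (fun x => f (x * h)%g)).
rewrite (_ : (fun=> _) = fun x => \sum_(q <- s) q.1 x * q.2 h).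
  by apply: sumr => q; apply: regfunM; [exact: cr_regular|exact: regfun_cst].
by apply: funext => x; exact: fs.
Qed.

Definition Int (a : A) : fgHom A A.
Proof.
exists (fun b : A => a * b * a^-1)%g.
- by move=> x y; rewrite !mulgA mulgVK.
- move=> f s; set t : Gam0 := (og_quo a * s * (og_quo a)^-1)%g.
  have /= rf := cr_regular f t.
  have [[_ _ rd] _ _ _] := dotP (val (og_quo a)).
  have := regfun_translate (og_ker a) (og_dot t (og_ker a)^-1)%g rf.
  move=> /(proj2 (rd _)); congr regfun; apply: funext => x /=.
  by rewrite {1}/t og_dot_mul.
Defined.

Variables (m : nat) (m_gt0 : (0 < m)%N).
Local Notation Hom := (muHom m_gt0 A).
Implicit Types (eta : Hom) (s : Gam0).

Definition conj_hom (a : A) (eta : Hom) : Hom := mu_comp (Int a) eta.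

(* The block H_s, for a given root of unity zeta in mu_m(K). *)
Definition block (zeta : mu m K^o) s : set Hom :=
  [set eta | gpt_map og_pi (mu_at m_gt0 (mh_co eta) zeta) = kpt (G := D) s].

Definition A_conj eta eta' := exists a : A, eta' = conj_hom a eta.
Definition G_conj eta eta' := exists g : G, eta' = conj_hom (og_incl g) eta.

Definition G_class eta : set Hom := [set eta' | G_conj eta eta'].
Definition G_classes (zeta : mu m K^o) s : set (set Hom) := G_class @` block zeta s.

Definition centralizer s : set Gam0 := [set t | (t * s = s * t)%g].
Definition cyclic_grp s : set Gam0 :=
  [set t | exists n, t = (s ^+ n)%g \/ t = (s ^- n)%g].
Definition lcoset_grp (t : Gam0) (L : set Gam0) : set Gam0 :=
  [set (t * l)%g | l in L].

(* Gam0 = A/G acts on blocks via any lift a of an element t of Gam0.  As some   *)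
(* blocks may be empty, a block carries its label.                             *)
Definition block_stabilizer (zeta : mu m K^o) s : set Gam0 :=
  [set t | forall a : A, og_quo a = t ->
    ((t * s * t^-1)%g, conj_hom a @` block zeta s) = (s, block zeta s)].
Definition block_set_stabilizer (zeta : mu m K^o) s : set Gam0 :=
  [set t | forall a : A, og_quo a = t -> conj_hom a @` block zeta s = block zeta s].

Definition has_order s n :=
  [/\ (0 < n)%N, (s ^+ n)%g = 1%g & forall d, (0 < d < n)%N -> (s ^+ d)%g <> 1%g].

Definition p_regular (p : nat) : set Gam0 :=
  [set s | p = 0%N \/ exists n, has_order s n /\ ~~ (p %| n)%N].

End Action.

Arguments conj_hom {K G S Gam0 m m_gt0} a eta.
Arguments block {K G S Gam0 m} m_gt0 zeta s _.
Arguments G_classes {K G S Gam0 m} m_gt0 zeta s _.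
Arguments block_stabilizer {K G S Gam0 m} m_gt0 zeta s _.
Arguments block_set_stabilizer {K G S Gam0 m} m_gt0 zeta s _.

(* Main.v *)
Require Import Defs.
From HB Require Import structures.
From mathcomp Require Import all_boot all_order all_algebra.
From mathcomp Require Import boolp classical_sets.

Set Implicit Arguments.
Unset Strict Implicit.
Unset Printing Implicit Defensive.

Import GRing.Theory.
Local Open Scope classical_set_scope.
Local Open Scope ring_scope.

(** Conjugation by an element over gamma conjugates by gamma the image of
    eta(zeta) in the discrete quotient, so it moves the block of sigma to the
    block of gamma sigma gamma^-1 ([image_block]); nonempty blocks determine
    their label ([block_inj]), which gives the stabilizers.

    The main point is that sigma fixes every G-conjugacy class in its block. For
    eta in the block of sigma, the value a = eta(zeta) is an element over sigma,
    and conjugation by a fixes eta because the roots of unity form a commutative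
    group scheme ([conj_value]). Hence every element over a power of sigma is the
    product of an element of G with an element that fixes eta
    ([cyclic_G_conj]), and the last two assertions follow formally.

    The value of eta at zeta is given as an algebra morphism to K, and eta is
    compatible with products only on functions f such that f(xy) is a finite sum
    of products of functions of x and of y. The value is evaluation at an actual
    element because it factors through one component, a copy of G
    ([point_over]). All regular functions on the semidirect product have such
    an expansion ([outer_comul]) because Gam0 is finite ([finite_outer]): an
    automorphism of the based root datum is determined by its effect on the
    simple roots, and these are among the weights of the torus on Lie(B), which
    is finite-dimensional because K[G] is finitely generated ([finite_weights]). *)

(** * Finiteness of the group of outer automorphisms *)

Section Finiteness.

Lemma bounded_uniq_seq (T : eqType) (P : set T) n :
  (forall r : seq T, uniq r -> (forall x, x \in r -> P x) -> (size r <= n)%N) ->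
  exists r : seq T, forall x, P x -> x \in r.
Proof.
elim: n P => [|n IHn] P bound.
  exists [::] => x Px; have : (size [:: x] <= 0)%N; last by [].
  by apply: bound => // y; rewrite inE => /eqP ->.
have [[x Px]|noP] := pselect (exists x, P x); last first.
  by exists [::] => x Px; case: noP; exists x.
have [r Pr] : exists r : seq T, forall y, P y /\ y <> x -> y \in r.
  apply: IHn => r r_uniq rP; have := bound (x :: r); rewrite /= r_uniq andbT.
  apply; first by apply/negP => /rP [].
  by move=> y; rewrite inE => /orP[/eqP -> //|/rP []].
exists (x :: r) => y Py; rewrite inE; case: eqVneq => //= /eqP yx.
exact: Pr.
Qed.

Variables (K : fieldType).

Definition weight_vector (G : borelTorusGroup K) (H : set G) (chi : character G)
    (d : coordRing G -> K) :=
  [/\ lie H d, exists f, d f <> 0 &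
      forall t, bt_T t -> forall f h : coordRing G,
        (forall x, h x = f (t * x * t^-1)%g) -> d h = chi t * d f].

(** Weight vectors for distinct characters of the torus are linearly
    independent, as in Artin's lemma: applying a linear relation to f composed
    with conjugation by t, and subtracting psi(t) times the relation itself,
    removes the term of psi from the relation. *)
Lemma weight_vectors_free (G : pinnedGroup K) (H : set G)
    (d : character G -> coordRing G -> K) (r : seq (character G))
    (c : character G -> K) :
  uniq r -> (forall chi, chi \in r -> weight_vector H chi (d chi)) ->
  (forall f, \sum_(chi <- r) c chi * d chi f = 0) ->
  forall chi, chi \in r -> c chi = 0.
Proof.
elim: r c => [|psi r IHr] c //= /andP[psiNr r_uniq] dP rel.
have dPr chi : chi \in r -> weight_vector H chi (d chi).
  by move=> chi_r; apply: dP; rewrite inE chi_r orbT.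
have c0 chi : chi \in r -> c chi = 0.
  move=> chi_r; have chiDpsi : chi <> psi by move=> E; rewrite -E chi_r in psiNr.
  apply: contrapT => /eqP c_neq0; apply: chiDpsi; apply: characterP => t Tt.
  suff /eqP : c chi * (chi t - psi t) = 0.
    by rewrite mulf_eq0 (negbTE c_neq0) subr_eq0 => /eqP.
  apply: (IHr (fun chi => c chi * (chi t - psi t)) r_uniq dPr _ chi chi_r) => f.
  (* h is f composed with conjugation by t, so Ad(t) d evaluated at f is d h. *)
  pose h := CoordRing (regfun_translate t t^-1%g (cr_regular f)).
  have := rel h; have := congr1 ( *%R (psi t)) (rel f).
  rewrite !big_cons mulr0 mulrDr mulr_sumr => relf relh.
  have dh phi : phi \in psi :: r -> d phi h = phi t * d phi f.
    by move=> /dP[_ _]; apply.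
  rewrite dh ?mem_head // in relh.
  transitivity (\sum_(phi <- r) c phi * d phi h - \sum_(phi <- r) psi t * (c phi * d phi f)).
    rewrite -sumrB; apply: eq_big_seq => phi phi_r.
    by rewrite dh ?inE ?phi_r ?orbT // mulrBr mulrBl mulrA [psi t * _]mulrCA mulrA.
  apply/eqP; rewrite subr_eq0 -(inj_eq (addrI (psi t * (c psi * d psi f)))).
  by rewrite relf mulrCA relh.
move=> chi; rewrite inE => /orP[/eqP ->|/c0 //].
have [_ [f df] _] := dP psi (mem_head _ _).
have := rel f; rewrite big_cons big1_seq ?addr0 => [|phi /c0 ->]; last first.
  by rewrite mul0r.
by move=> /eqP; rewrite mulf_eq0 => /orP[/eqP //|/eqP].
Qed.

Lemma lie_sum (I : eqType) (G : funGroup K) (H : set G) (r : seq I)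
    (c : I -> K) (d : I -> coordRing G -> K) :
  (forall i, i \in r -> lie H (d i)) -> lie H (fun f => \sum_(i <- r) c i * d i f).
Proof.
move=> lieP; split=> [a f g|f g|f Hf].
- rewrite mulr_sumr -big_split; apply: eq_big_seq => i /lieP[-> _ _] /=.
  by rewrite mulrDr mulrCA.
- rewrite mulr_sumr mulr_suml -big_split; apply: eq_big_seq => i /lieP[_ -> _] /=.
  by rewrite mulrDr mulrCA [c i * (d i f * _)]mulrA.
- by apply: big1_seq => i /lieP[_ _ ->] //; rewrite mulr0.
Qed.

(** By the Leibniz rule the functions killed by a point derivation contain the
    subalgebra generated by any of its subsets; hence Lie(G) has dimension at
    most the number of generators of K[G]. *)
Lemma lie_eq0 (G : funGroup K) (H : set G) (gens : seq (coordRing G))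
    (d : coordRing G -> K) :
  (forall A : set (coordRing G),
    (forall c : K, A c%:A) -> (forall f g, A f -> A g -> A (f + g)) ->
    (forall f g, A f -> A g -> A (f * g)) ->
    (forall f, f \in gens -> A f) -> forall f, A f) ->
  lie H d -> (forall f, f \in gens -> d f = 0) -> forall f, d f = 0.
Proof.
move=> gensP [dlin dmul _] dgens.
have d1 : d 1 = 0.
  have := dmul 1 1; rewrite mulr1 /= mul1r mulr1 => /eqP.
  by rewrite -[X in X == _]addr0 (inj_eq (addrI _)) => /eqP.
have d0 : d 0 = 0 by have := dlin (-1) 0 0; rewrite scaler0 addr0 mulN1r addNr.
apply: gensP => // [c|f g f0 g0|f g f0 g0].
- by have := dlin c 1 0; rewrite addr0 d1 d0 mulr0 addr0.
- by have := dlin 1 f g; rewrite scale1r f0 g0 mulr0 addr0.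
- by rewrite dmul f0 g0 mulr0 mul0r addr0.
Qed.

(** If there were more weights than generators of K[G], the matrix of the
    values of weight vectors on the generators would have dependent rows; the
    dependency would extend to all of K[G] and contradict
    [weight_vectors_free]. *)
Lemma finite_weights (G : pinnedGroup K) (H : set G) :
  exists r : seq (character G), forall chi, weight_in H chi -> chi \in r.
Proof.
have [[gens gensP] _ _ _] := bt_algebraic G.
apply: (@bounded_uniq_seq _ _ (size gens)) => r r_uniq rW; rewrite leqNgt.
apply/negP => lt_gens.
have /choice[d dP] : forall chi, exists d, chi \in r -> weight_vector H chi d.
  move=> chi; case chi_r: (chi \in r); last by exists (fun=> 0).
  by have [d wd] := rW _ chi_r; exists d.
pose M := \matrix_(j < size r, i < size gens) d (nth 0 r j) (nth 0 gens i).
have : kermx M != 0.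
  by rewrite kermx_eq0 /row_free ltn_eqF // (leq_ltn_trans (rank_leq_col M)).
case/rowV0Pn => u /sub_kermxP uM u_neq0.
(* u is indexed by positions in r; c is the same family indexed by characters. *)
pose c chi := if insub (index chi r) is Some j then u 0 j else 0.
have cE (j : 'I_(size r)) : c (nth 0 r j) = u 0 j.
  by rewrite /c index_uniq // valK.
have c0 : forall chi, chi \in r -> c chi = 0.
  apply: (weight_vectors_free r_uniq dP).
  have lieD : lie H (fun f => \sum_(chi <- r) c chi * d chi f).
    by apply: lie_sum => chi /dP[].
  apply: (lie_eq0 gensP lieD) => f /(nthP 0)[i ltig <-].
  have := congr1 (fun v : 'rV_(size gens) => v 0 (Ordinal ltig)) uM.
  rewrite !mxE => uM0; rewrite (big_nth 0) big_mkord -[RHS]uM0.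
  by apply: eq_bigr => j _; rewrite mxE cE.
by case/rV0Pn: u_neq0 => j; rewrite -cE c0 ?eqxx // mem_nth.
Qed.

End Finiteness.

(** The pinning condition on an automorphism of G mentions s only through its
    values on simple roots, so s and t have the same pinned automorphism; and
    that automorphism determines the action on characters. *)
Lemma basedAut_eq_simple (K : fieldType) (G : pinnedGroup K) (s t : basedAut G) :
  (forall a, simple_root a -> s a = t a) -> s = t.
Proof.
move=> st; apply: basedAutP => chi.
have [phi [phiP phi_chi _]] := pg_dot s.
have [psi [_ psi_chi psi_unique]] := pg_dot t.
have phiE : phi = psi.
  apply: psi_unique; have [aut B T eps] := phiP; split=> // a x sa.
  by rewrite -st // eps.
have [_ _ imT _] := phiP; apply: characterP => t0.
by rewrite -{1}imT => -[u Tu <-]; rewrite phi_chi // phiE psi_chi.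
Qed.

(** An element of Gam0 is determined by a self-map of a finite set of characters
    that contains the simple roots. Finiteness is what makes the function algebra of
    the semidirect product a bialgebra: over an infinite discrete group, an
    arbitrary function of a product is not a finite sum of products. *)
Lemma finite_outer (K : fieldType) (G : pinnedGroup K) (S : pred (basedAut G))
    (Gam0 : subGroupType S) : exists E : seq Gam0, forall s, s \in E.
Proof.
have [R RP] := finite_weights (@bt_B K G).
have simpleR a : simple_root a -> a \in R.
  by case=> -[_ wa] _; exact: RP.
(* Outside the simple roots s may leave R; the default x is used there. *)
pose code (s : Gam0) : {ffun seq_sub R -> seq_sub R} :=
  [ffun x => insubd x (val s (val x))].
have code_inj : injective code.
  move=> s t st; apply: val_inj; apply: basedAut_eq_simple => a sa.
  have := congr1 (fun g : {ffun _ -> _} => val (g (SeqSub (simpleR a sa)))) st.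
  by rewrite !ffunE !val_insubd !simpleR ?ba_simple.
have [|E EP] := @bounded_uniq_seq Gam0 setT #|{ffun seq_sub R -> seq_sub R}|.
  move=> r r_uniq _.
  by rewrite -(size_map code) -(card_uniqP _) ?map_inj_uniq // max_card.
by exists E => s; exact: EP.
Qed.

(** * The coordinate ring of the semidirect product *)

Section Tensors.
Variables (K : fieldType) (G : funGroup K).
Implicit Types F : G -> G -> K.

Definition tensor F := exists l : seq (coordRing G * coordRing G),
  forall x y, F x y = \sum_(p <- l) p.1 x * p.2 y.

Lemma tensor_sum (I : Type) (r : seq I) (F : I -> G -> G -> K) :
  (forall i, tensor (F i)) -> tensor (fun x y => \sum_(i <- r) F i x y).
Proof.
move=> FP; elim: r => [|i r [l lP]].
  by exists [::] => x y; rewrite !big_nil.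
have [l' l'P] := FP i; exists (l' ++ l) => x y.
by rewrite big_cons big_cat -l'P -lP.
Qed.

End Tensors.

Section Components.
Variables (K : fieldType) (G : pinnedGroup K) (S : pred (basedAut G)).
Variable Gam0 : subGroupType S.
Local Notation A := (outer_fg Gam0).
Local Notation D := (discrete_fg Gam0).

Lemma ext_regular (s : Gam0) (f : coordRing G) :
  regfun (fun x : A => if og_quo x == s then f (og_ker x) else 0).
Proof.
move=> t /=; case: (t == s); [exact: cr_regular | exact: regfun_cst].
Qed.

Definition ext_by_zero (s : Gam0) (f : coordRing G) : coordRing A :=
  CoordRing (ext_regular s f).

Definition restr (s : Gam0) (f : coordRing A) : coordRing G :=
  CoordRing (cr_regular f s).

Lemma dot_regular (s : Gam0) (f : coordRing G) : regfun (f \o og_dot s).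
Proof.
by have [[_ _ rd] _ _ _] := dotP (val s); apply/rd; exact: cr_regular.
Qed.

(** On the product of the components of s and t, the function f(xy) is
    f_(st)(g * dot s h), where x = (g, s), y = (h, t) and f_(st) is the restriction
    of f to the component of st. This is a tensor because G has a comultiplication
    and dot s is a morphism of varieties. As Gam0 is finite, the sum of the pieces
    over all s and t is a tensor as well. *)
Lemma outer_comul (f : coordRing A) : exists l, comul f l.
Proof.
have [E EP] := finite_outer Gam0.
have [_ _ comG _] := bt_algebraic G.
(* The extensions of 1 are the indicator functions of the two components. *)
suff [l lP] : tensor (fun x y : A => \sum_(s <- undup E) \sum_(t <- undup E)
    ext_by_zero s 1 x * ext_by_zero t 1 y * f (x * y)%g).
  exists l => x y; rewrite -lP.
  rewrite (bigD1_seq (og_quo x)) ?undup_uniq ?mem_undup //=.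
  rewrite [X in _ + X]big1 ?addr0 => [|s]; last first.
    rewrite eq_sym => /negPf sx; apply: big1 => t _.
    by rewrite sx !mul0r.
  rewrite (bigD1_seq (og_quo y)) ?undup_uniq ?mem_undup //=.
  rewrite [X in _ + X]big1 ?addr0 => [|t]; last first.
    by rewrite eq_sym => /negPf ty; rewrite ty mulr0 mul0r.
  by rewrite !eqxx !mul1r.
apply: tensor_sum => s; apply: tensor_sum => t.
have [l lP] := comG (restr (s * t)%g f).
exists [seq (ext_by_zero s q.1, ext_by_zero t (CoordRing (dot_regular s q.2)))
       | q <- l] => x y.
rewrite big_map /=; case: x y => [g s'] [h t'] /=.
case: eqP => [->|_]; last by rewrite !mul0r big1 // => q _; rewrite mul0r.
case: eqP => [->|_]; last by rewrite mulr0 mul0r big1 // => q _; rewrite mulr0.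
by rewrite !mul1r -lP.
Qed.

Section PointOver.
Variables (x : gpt A K^o) (s : Gam0).
Hypothesis x_over : gpt_map (og_pi Gam0) x = kpt (G := D) s.

(** A point over s sends the idempotent of the component of s to 1, so it factors
    through the coordinate ring of that component, a copy of G; slice is the
    resulting point of G. *)
Definition slice (f : coordRing G) : K^o := x (ext_by_zero s f).

Lemma slice_indicator : x (ext_by_zero s 1) = 1.
Proof.
pose e : coordRing D := @CoordRing K D (fun t => (t == s)%:R) I.
have := congr1 (fun y : gpt D K^o => y e) x_over.
rewrite /= /ev_at /= eqxx => xe; rewrite -[RHS]xe; congr (x _).
by apply: coordRingP => a /=; case: eqP.
Qed.

Lemma slice_is_linear : linear slice.
Proof.
move=> c f g; rewrite /slice -linearP; congr (x _); apply: coordRingP => a /=.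
by case: eqP; rewrite // mulr0 addr0.
Qed.

Lemma slice_is_mult : monoid_morphism slice.
Proof.
split=> [|f g]; first exact: slice_indicator.
rewrite /slice -rmorphM; congr (x _); apply: coordRingP => a /=.
by case: eqP; rewrite // mulr0.
Qed.

HB.instance Definition _ :=
  GRing.isLinear.Build K (coordRing G) K^o _ slice slice_is_linear.
HB.instance Definition _ :=
  GRing.isMonoidMorphism.Build (coordRing G) K^o slice slice_is_mult.

(** The points of G over K being its elements, a point of the semidirect product
    whose image in the discrete quotient is s is evaluation at an element. *)
Lemma point_over : exists a : A, og_quo a = s /\ forall f, x f = f a.
Proof.
have [_ ptG _ _] := bt_algebraic G.
have [g [gP _]] := ptG (slice : gpt G K^o).
exists (Outer g s); split=> // f.
have -> : x f = x f * x (ext_by_zero s 1) by rewrite slice_indicator mulr1.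
rewrite -rmorphM; transitivity (slice (restr s f)); last exact: gP.
congr (x _); apply: coordRingP => -[h t] /=.
by case: eqP => [->|]; rewrite ?mulr1 ?mulr0.
Qed.

End PointOver.
End Components.

(** * The generic point of the scheme of roots of unity *)

Lemma lrmorphismP (K : fieldType) (R : comAlgType K) (R' : comAlgType K)
  (f g : {lrmorphism R -> R'}) : f =1 g -> f = g.
Proof.
case: f g => [f [[f1] [f2] [f3]]] [g [[g1] [g2] [g3]]] /= /funext fg.
case: _ / fg g1 g2 g3 => g1 g2 g3.
by rewrite (Prop_irrelevance f1 g1) (Prop_irrelevance f2 g2) (Prop_irrelevance f3 g3).
Qed.

Section MuHom.
Variables (K : fieldType) (m : nat) (m_gt0 : (0 < m)%N).

Lemma muHomP (G : funGroup K) (eta eta' : muHom m_gt0 G) :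
  mh_co eta =1 mh_co eta' -> eta = eta'.
Proof.
case: eta eta' => [co mul] [co' mul'] /= /lrmorphismP co_eq.
by case: _ / co_eq mul' => mul'; rewrite (Prop_irrelevance mul mul').
Qed.

Lemma gen_mu_proof : ('qX : muRing K m) ^+ m == 1.
Proof.
rewrite -subr_eq0 -(in_qpoly1 ('X^m - 1)) -rmorphXn -rmorphB.
apply/eqP/val_inj; rewrite /= /mk_monic size_XnsubC // ltnS m_gt0 monicXnsubC //=.
exact: (Pdiv.RingMonic.rmodpp (monicXnsubC 1 m_gt0)).
Qed.

(** The tautological point over the coordinate ring: a morphism out of the scheme
    of m-th roots of unity is recovered from its value here. *)
Definition gen_mu : mu m (muRing K m) := Sub 'qX gen_mu_proof.

Lemma mu_ev_gen (q : muRing K m) : mu_ev m_gt0 gen_mu q = q.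
Proof.
rewrite /mu_ev /= -(poly_alg_initial (in_qpoly _)); apply: val_inj.
by rewrite /= Pdiv.CommonRing.rmodp_small // size_mk_monic.
Qed.

Lemma base_change_mu_proof (R : comAlgType K) (z : mu m K^o) : ((val z)%:A : R) ^+ m == 1.
Proof.
rewrite -[_%:A]/(GRing.in_alg R _) -rmorphXn /= [X in X *: _](eqP (valP z)).
by rewrite scale1r.
Qed.

Definition base_change_mu (R : comAlgType K) (z : mu m K^o) : mu m R :=
  Sub (val z)%:A (base_change_mu_proof R z).

Lemma mu_ev_const (R : comAlgType K) (z : mu m K^o) (q : muRing K m) :
  mu_ev m_gt0 (base_change_mu R z) q = (mu_ev m_gt0 z q)%:A.
Proof.
rewrite /mu_ev /=; elim/poly_ind: (polyn q) => [|p c IHp].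
  by rewrite !rmorph0 scale0r.
rewrite !rmorphD !rmorphM /= !horner_algX !horner_algC IHp.
rewrite scalerDl -scalerAr mulr1 scalerA (mulrC _ (sval z)).
by congr (_ + _ *: 1); rewrite /GRing.scale /= mulr1.
Qed.

End MuHom.

(** * Conjugation of morphisms *)

Section Conjugation.
Variables (K : fieldType) (G : pinnedGroup K) (S : pred (basedAut G)).
Variable Gam0 : subGroupType S.
Local Notation A := (outer_fg Gam0).
Local Notation D := (discrete_fg Gam0).
Variables (m : nat) (m_gt0 : (0 < m)%N).
Local Notation Hom := (muHom m_gt0 A).
Implicit Types (eta : Hom) (a b : A) (s t : Gam0) (zeta : mu m K^o).

Lemma conj_homE a eta (f h : coordRing A) :
  (forall b, h b = f (a * b * a^-1)%g) -> mh_co (conj_hom a eta) f = mh_co eta h.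
Proof. by move=> hf; congr (mh_co eta _); apply: coordRingP => b /=; rewrite hf. Qed.

Lemma conj_hom1 eta : conj_hom 1%g eta = eta.
Proof.
by apply: muHomP => f; apply: conj_homE => b; rewrite mul1g invg1 mulg1.
Qed.

Lemma conj_homM a b eta : conj_hom (a * b)%g eta = conj_hom a (conj_hom b eta).
Proof.
apply: muHomP => f; apply: conj_homE => c.
by rewrite /= invgM !mulgA.
Qed.

Lemma conj_homK a : cancel (conj_hom a) (conj_hom a^-1%g : Hom -> Hom).
Proof. by move=> eta; rewrite -conj_homM mulVg conj_hom1. Qed.

Lemma conj_homVK a : cancel (conj_hom a^-1%g) (conj_hom a : Hom -> Hom).
Proof. by move=> eta; rewrite -conj_homM mulgV conj_hom1. Qed.

Lemma blockP zeta s eta : block m_gt0 zeta s eta <->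
  forall f : coordRing D, mu_ev m_gt0 zeta (mh_co eta (pullback (og_pi Gam0) f)) = f s.
Proof.
split=> [bl f|bl]; last by apply: lrmorphismP => f; exact: bl.
exact: (congr1 (fun x : gpt D K^o => x f) bl).
Qed.

Lemma block_conj zeta s a eta : block m_gt0 zeta s eta ->
  block m_gt0 zeta (og_quo a * s * (og_quo a)^-1)%g (conj_hom a eta).
Proof.
move=> /blockP bl; apply/blockP => f.
pose h : coordRing D :=
  @CoordRing K D (fun t => f (og_quo a * t * (og_quo a)^-1)%g) I.
by rewrite (conj_homE eta (h := pullback (og_pi Gam0) h)) ?bl.
Qed.

(** Indicator functions separate the points of the discrete quotient. *)
Lemma block_inj zeta s t eta :
  block m_gt0 zeta s eta -> block m_gt0 zeta t eta -> s = t.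
Proof.
move=> /blockP bs /blockP bt.
pose e : coordRing D := @CoordRing K D (fun t' => (t' == t)%:R) I.
have := bs e; rewrite bt /= eqxx; case: eqP => // _ /eqP.
by rewrite oner_eq0.
Qed.

Lemma image_block zeta s a : conj_hom a @` block m_gt0 zeta s =
  block m_gt0 zeta (og_quo a * s * (og_quo a)^-1)%g.
Proof.
apply/seteqP; split=> [_ [eta bl <-]|eta bl]; first exact: block_conj.
exists (conj_hom a^-1%g eta); last exact: conj_homVK.
have := block_conj a^-1%g bl; rewrite /= invgK !mulgA mulVg mul1g.
by rewrite -mulgA mulVg mulg1.
Qed.

Lemma coordRing_sumE (I : Type) (r : seq I) (F : I -> coordRing A) x :
  (\sum_(i <- r) F i) x = \sum_(i <- r) F i x.
Proof. by elim/big_rec2: _ => //= i _ f _ <-. Qed.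

Lemma outer_regular_mulr b (f : coordRing A) : regfun (fun x : A => f (x * b)%g).
Proof.
move=> s; pose h := CoordRing (cr_regular f (s * og_quo b)%g).
have := regfun_translate 1%g (og_dot s (og_ker b)) (cr_regular h).
by congr regfun; apply: funext => x; rewrite /= mul1g.
Qed.

(** The element a is the value of eta at zeta. As the scheme of roots of unity
    is commutative, a commutes with the value of eta at the generic point u;
    that value is the comorphism of eta, so conjugation by a fixes eta. *)
Lemma conj_value zeta s eta : block m_gt0 zeta s eta ->
  exists a, og_quo a = s /\ conj_hom a eta = eta.
Proof.
move=> bl; have [a [a_s aP]] := point_over bl; exists a; split=> //.
pose u := gen_mu K m_gt0; pose z := base_change_mu (muRing K m) zeta.
have zE f : mu_at m_gt0 (mh_co eta) z f = (f a)%:A.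
  by rewrite /mu_at /= mu_ev_const -aP.
have uE f : mu_at m_gt0 (mh_co eta) u f = mh_co eta f.
  by rewrite /mu_at /= mu_ev_gen.
have uz : mu_mul u z = mu_mul z u by apply: val_inj; rewrite /= mulrC.
have swap (f fl fr : coordRing A) : (forall b, fl b = f (a * b)%g) ->
    (forall b, fr b = f (b * a)%g) -> mh_co eta fl = mh_co eta fr.
  move=> flE frE; have [l lP] := outer_comul f.
  have -> : fl = \sum_(p <- l) p.1 a *: p.2.
    by apply: coordRingP => b; rewrite flE lP coordRing_sumE.
  have -> : fr = \sum_(p <- l) p.2 a *: p.1.
    apply: coordRingP => b; rewrite frE lP coordRing_sumE.
    by apply: eq_bigr => p _; exact: mulrC.
  rewrite !linear_sum; transitivity (mu_at m_gt0 (mh_co eta) (mu_mul z u) f).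
    rewrite (mh_mul eta z u lP); apply: eq_bigr => p _.
    by rewrite zE uE linearZ mulr_algl.
  rewrite -uz (mh_mul eta u z lP); apply: eq_bigr => p _.
  by rewrite zE uE linearZ mulr_algr.
apply: muHomP => f.
(* swap compares f(a x a^-1) with f(x), as g(a x) and g(x a) for g(x) = f(x a^-1). *)
pose g := CoordRing (outer_regular_mulr a^-1%g f).
rewrite (conj_homE eta (h := pullback (Int a) f)) //.
by apply: (swap g) => b //=; rewrite mulgK.
Qed.

Lemma quo_incl a b : og_quo a = og_quo b -> exists g : G, a = (og_incl Gam0 g * b)%g.
Proof.
case: a b => [g s] [h t] /= ->; exists (g * h^-1)%g.
by congr Outer; rewrite /= ?og_dot_id ?mulgVK ?mul1g.
Qed.

Lemma incl_conj a (g : G) : exists h : G, (a * og_incl Gam0 g = og_incl Gam0 h * a)%g.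
Proof. by apply: quo_incl; rewrite /= mulg1. Qed.

Lemma og_inclM (g h : G) : og_incl Gam0 (g * h)%g = (og_incl Gam0 g * og_incl Gam0 h)%g.
Proof. by congr Outer; rewrite /= ?og_dot_id ?mulg1. Qed.

Lemma G_conj_sym eta eta' : G_conj eta eta' -> G_conj eta' eta.
Proof.
case=> g ->; exists g^-1%g; rewrite -conj_homM -og_inclM mulVg.
by rewrite -[LHS]conj_hom1.
Qed.

Lemma G_conj_trans eta eta' eta'' :
  G_conj eta eta' -> G_conj eta' eta'' -> G_conj eta eta''.
Proof. by move=> [g ->] [h ->]; exists (h * g)%g; rewrite og_inclM conj_homM. Qed.

Lemma eq_G_class eta eta' : G_conj eta eta' -> G_class eta = G_class eta'.
Proof.
move=> ee'; apply/seteqP; split=> e; apply: G_conj_trans => //.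
exact: G_conj_sym.
Qed.

Lemma image_G_class a eta : conj_hom a @` G_class eta = G_class (conj_hom a eta).
Proof.
apply/seteqP; split=> [_ [_ [g ->] <-]|_ [g ->]].
  by have [h hP] := incl_conj a g; exists h; rewrite -!conj_homM hP.
have [h hP] := incl_conj a^-1%g g.
exists (conj_hom (og_incl Gam0 h) eta); first by exists h.
rewrite -!conj_homM; congr conj_hom.
by apply: (mulgI a^-1%g); rewrite !mulgA mulVg mul1g hP mulgVK.
Qed.

(** The powers of the element given by [conj_value] fix eta and represent every
    element of the group generated by s; any other representative differs from
    them by an element of G. *)
Lemma cyclic_G_conj zeta s eta a : block m_gt0 zeta s eta ->
  cyclic_grp s (og_quo a) -> G_conj eta (conj_hom a eta).
Proof.
move=> bl; have [b [b_s fixb]] := conj_value bl.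
have fixX n : conj_hom (b ^+ n)%g eta = eta.
  elim: n => [|n IHn]; first exact: conj_hom1.
  by rewrite expgSr conj_homM fixb.
have fixV n : conj_hom (b ^- n)%g eta = eta.
  by rewrite -{1}[eta](fixX n) conj_homK.
have quoX n : og_quo (b ^+ n)%g = (s ^+ n)%g.
  by elim: n => [|n IHn] //; rewrite !expgS /= IHn b_s.
have lift c : conj_hom c eta = eta -> og_quo a = og_quo c ->
    G_conj eta (conj_hom a eta).
  by move=> fixc /quo_incl[g ->]; exists g; rewrite conj_homM fixc.
by case=> n [sn|sn]; [apply: (lift _ (fixX n))|apply: (lift _ (fixV n))];
  rewrite sn /= quoX.
Qed.

End Conjugation.

(** * The action on blocks and on conjugacy classes *)

Theorem proposition5p9 (K : closedFieldType) (p : nat)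
    (charK : p \in [pchar K] \/ p = 0%N /\ [pchar K] =i pred0)
    (m : nat) (m_gt0 : (0 < m)%N) (m' k : nat)
    (m'E : if p == 0%N then m' = m else m = (m' * p ^ k)%N /\ coprime m' p)
    (zeta : mu m K^o) (zeta_prim : m'.-primitive_root (val zeta : K))
    (G : pinnedGroup K) (S : pred (basedAut G)) (Gam0 : subGroupType S)
    (sigma : Gam0) (sigma_reg : p_regular p sigma) :
  [/\ forall (a : outerGroup Gam0) (gamma : Gam0), og_quo a = gamma ->
        conj_hom a @` block m_gt0 zeta sigma =
        block m_gt0 zeta (gamma * sigma * gamma^-1)%g,
      block_stabilizer m_gt0 zeta sigma = centralizer sigma,
      block m_gt0 zeta sigma !=set0 ->
        block_set_stabilizer m_gt0 zeta sigma = centralizer sigma,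
      exists rho : set Gam0 -> set (muHom m_gt0 (outer_fg Gam0)) ->
                   set (muHom m_gt0 (outer_fg Gam0)),
        forall (a : outerGroup Gam0) c,
          centralizer sigma (og_quo a) -> G_classes m_gt0 zeta sigma c ->
          G_classes m_gt0 zeta sigma (conj_hom a @` c) /\
          conj_hom a @` c = rho (lcoset_grp (og_quo a) (cyclic_grp sigma)) c &
      centralizer sigma = cyclic_grp sigma ->
        forall eta eta', block m_gt0 zeta sigma eta -> block m_gt0 zeta sigma eta' ->
          (A_conj eta eta' <-> G_conj eta eta')].
Proof.
have quoV (t : Gam0) : centralizer sigma t <-> (t * sigma * t^-1)%g = sigma.
  split=> [tc|tc]; first by rewrite /centralizer /= in tc; rewrite tc mulgK.
  by rewrite /centralizer /= -{2}tc mulgVK.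
split.
- by move=> a _ <-; exact: image_block.
- apply/seteqP; split=> t tP.
    by have [] := tP (Outer 1%g t) erefl => /quoV.
  by move=> a a_t; rewrite image_block a_t; move/quoV: tP => ->.
- move=> [eta bl]; apply/seteqP; split=> t tP.
    apply/quoV; have := tP (Outer 1%g t) erefl; rewrite image_block /= => E.
    by apply: (@block_inj _ _ _ _ _ m_gt0 zeta _ _ eta _ bl); rewrite E.
  by move=> a a_t; rewrite image_block a_t; move/quoV: tP => ->.
(* The union avoids choosing a representative of the coset L: its terms all
   coincide when c is a class in the block and L a coset in the centralizer. *)
- exists (fun L c => \bigcup_(b in [set b : outerGroup Gam0 | L (og_quo b)])
      conj_hom b @` c) => a _ ac [eta bl <-].
  have bla : block m_gt0 zeta sigma (conj_hom a eta).
    by have := block_conj a bl; rewrite (quoV _).1.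
  split; first by exists (conj_hom a eta) => //; rewrite image_G_class.
  apply/seteqP; split=> [e ea|e [b [l lP bE]] eb].
    by exists a => //=; exists 1%g; [exists 0%N; left|rewrite mulg1].
  have bA : og_quo (b : outer_fg Gam0) = og_quo (a * Outer 1%g l : outer_fg Gam0)%g.
    by [].
  have [g bg] := quo_incl bA.
  have lg : G_conj (conj_hom a (conj_hom (Outer 1%g l) eta)) (conj_hom b eta).
    by exists g; rewrite bg !conj_homM.
  have /eq_G_class lE : G_conj eta (conj_hom (Outer 1%g l) eta).
    exact: (cyclic_G_conj bl).
  move: eb; rewrite image_G_class -(eq_G_class lg).
  by rewrite -image_G_class -lE.
- move=> cE eta eta' bl bl'; split=> [[a aE]|[g ->]]; last by exists (og_incl Gam0 g).
  rewrite aE; apply: (cyclic_G_conj bl); rewrite -cE; apply/quoV.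
  by apply: block_inj (block_conj a bl) _; rewrite -aE.
Qed.
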